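(* Let $K$ be a field and let $I$ be a squarefree monomial ideal of $S=K[x_1,\ldots,x_n]$, with associated hypergraph $\mathcal H(I)$. Then the following conditions are equivalent: (1) $I^{(2)}=I^2$ holds. (2) Whenever edges $H_1,H_2,H_3$ of $\mathcal H(I)$ make a special triangle, one has $x^{H_1\cap H_2\cap H_3}\,x^{H_1\cup H_2\cup H_3}\in I^2$.
   Context: For $H=\{i_1,\ldots,i_r\}\subseteq[n]$ write $x^H=x_{i_1}\cdots x_{i_r}$. Let $G(I)=\{x^{H_1},\ldots,x^{H_\mu}\}$ be the minimal set of monomial generators of $I$. The associated hypergraph $\mathcal H(I)$ has vertex set $V=[n]$ and edge set $\{H_1,\ldots,H_\mu\}$; $H\in\mathcal H(I)$ means that $H$ is an edge. A set $\{i,j,k\}$ of three distinct vertices is a special triangle of $\mathcal H(I)$ if there exist edges $H_i,H_j,H_k\in\mathcal H(I)$ with $H_i\cap\{i,j,k\}=\{j,k\}$, $H_j\cap\{i,j,k\}=\{i,k\}$, $H_k\cap\{i,j,k\}=\{i,j\}$; in that case one says that $H_i,H_j,H_k$ make a special triangle $\{i,j,k\}$. The second symbolic power of the radical ideal $I$ with minimal primes $P_1,\ldots,P_r$ is $I^{(2)}=\bigcap_{i=1}^r (P_i^2S_{P_i}\cap S)$; for squarefree monomial $I$ this equals $\bigcap_{i=1}^r P_i^2$. *)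

(* Defs.v *)
From mathcomp Require Import all_boot all_order all_algebra.
From mathcomp Require Import classical_sets.
From mathcomp Require Import mpoly.

Set Implicit Arguments.
Unset Strict Implicit.
Unset Printing Implicit Defensive.

Import GRing.Theory.
Local Open Scope classical_set_scope.
Local Open Scope ring_scope.

Section Ideals.
Variable R : comNzRingType.
Implicit Types (A B I J P : set R).

(* [J] is an ideal of the subring [B] of [R]; it need not be proper, in
   contrast with [idealr_closed]. *)
Definition ideal_of B J : Prop :=
  [/\ J `<=` B, J 0, forall x y, J x -> J y -> J (x + y)
    & forall b x, B b -> J x -> J (b * x)].

Definition ideal_gen_in B A : set R := smallest (ideal_of B) A.

Definition ideal_gen A : set R := ideal_gen_in [set: R] A.

Definition ideal_mul I J : set R :=
  ideal_gen [set z | exists x y, [/\ I x, J y & z = x * y]].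

Definition ideal_exp I (k : nat) : set R := iterop k ideal_mul I [set: R].

Definition prime_ideal P : Prop :=
  idealr_closed [pred x in P] /\ prime_idealr_closed [pred x in P].

Definition minimal_prime I P : Prop :=
  [/\ prime_ideal P, I `<=` P
    & forall Q, prime_ideal Q -> I `<=` Q -> Q `<=` P -> Q = P].

End Ideals.

Section SymbolicPower.
Variable S : idomainType.
Implicit Types I P : set S.

(* [S] is a domain, so that [S_P] embeds in its field of fractions. *)
Definition localization P : set {fraction S} :=
  [set z | exists a s : S, ~ P s /\ z = tofrac a / tofrac s].

Definition local_power P (k : nat) : set {fraction S} :=
  ideal_gen_in (localization P) (@tofrac S @` ideal_exp P k).

Definition symbolic_power I (k : nat) : set S :=
  \bigcap_(P in minimal_prime I) (@tofrac S @^-1` local_power P k).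

End SymbolicPower.

Section Hypergraph.
Variables (n : nat) (K : fieldType).
Local Notation S := {mpoly K[n]}.
Implicit Types (I G : set S) (H : {set 'I_n}).

Definition xset H : S := \prod_(i in H) 'X_i.

Definition squarefree_monomial_ideal I : Prop :=
  exists A : set {set 'I_n}, I = ideal_gen (xset @` A).

Definition generates_by_monomials I G : Prop :=
  G `<=` range (fun m : 'X_{1..n} => 'X_[m]) /\ ideal_gen G = I.

Definition min_monomial_gens I G : Prop :=
  generates_by_monomials I G /\
  forall G', generates_by_monomials I G' -> G' `<=` G -> G' = G.

(* A monomial ideal has exactly one minimal set [G] of monomial generators. *)
Definition hypergraph I : set {set 'I_n} :=
  [set H | exists2 G, min_monomial_gens I G & G (xset H)].

End Hypergraph.

Definition makes_triangle_on (n : nat) (E : set {set 'I_n})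
    (i j k : 'I_n) (Hi Hj Hk : {set 'I_n}) : Prop :=
  [/\ [/\ i != j, i != k & j != k],
      [/\ E Hi, E Hj & E Hk]
    & let T := [set i; j; k]%SET in
      [/\ Hi :&: T = [set j; k]%SET,
          Hj :&: T = [set i; k]%SET
        & Hk :&: T = [set i; j]%SET]].

Definition make_special_triangle (n : nat) (E : set {set 'I_n})
    (H1 H2 H3 : {set 'I_n}) : Prop :=
  exists i j k, makes_triangle_on E i j k H1 H2 H3.

(* Main.v *)
From HB Require Import structures.
Require Import Defs.
From mathcomp Require Import all_boot all_order all_algebra.
From mathcomp Require Import boolp classical_sets.
From mathcomp Require Import mpoly.
Local Open Scope ring_scope.

Import GRing.Theory.

Set Implicit Arguments.
Unset Strict Implicit.
Unset Printing Implicit Defensive.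

(** Write [E] for the edge set of the hypergraph of [I]; the edges are the
    exponents of the minimal generators, so [x^E] generates [I]
    ([ideal_gen_hypergraph]).

    The inclusion of the square in the symbolic square is formal.  For the
    necessity of the condition on special triangles, let [u] be the product of
    the monomials of the intersection and of the union of three edges.  Every
    prime containing [I] contains a variable [x_v] with [v] in the first edge.
    Either [v] lies in all three edges and [x_v ^ 2] divides [u], or some edge
    avoids [v], and a variable of that edge lying in the prime gives a second
    factor.  Thus [u] is in the symbolic square ([triple_in_symbolic]).

    For sufficiency, let [f] be in the symbolic square and [m] a monomial
    of [f].  A minimal vertex cover [C] gives the minimal prime generated by
    the variables of [C]; grading by total degree in those variables shows
    that membership in the local square of this prime forces [m] to have
    weight at least 2 on [C] ([symbolic_square_weight]).  Let [F] be the
    support of [m] and [D] the set of vertices of exponent at least 2.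
    The complement of [F] has weight 0, so it is not a cover and [F] contains an
    edge; likewise [F] minus [v] contains an edge for each [v] in [F] outside
    [D], since its complement has weight 1.  Choose edges [H], [H']
    inside [F] with as few common vertices outside [D] as possible.  If a common
    vertex [v] outside [D] remains, take an edge [H''] in [F] avoiding [v].
    When [H :&: H''] is inside [H'], or [H' :&: H''] inside [H], one of these
    pairs has fewer common vertices outside [D].  Otherwise [H], [H'], [H'']
    make a special triangle, and the hypothesis provides two edges in [F] whose
    intersection is inside [H :&: H' :&: H''], again a better pair.  So
    [H :&: H'] is inside [D], and the product of the two generators divides [m]
    ([two_edges_of_special_triangles]). *)

(** * Ideals and their generators *)

Section IdealGeneration.
Variable R : comNzRingType.
Implicit Types (A B J : set R).
Local Open Scope classical_set_scope.

Lemma sub_ideal_gen A : A `<=` ideal_gen A.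
Proof. exact: sub_gen_smallest. Qed.

Lemma ideal_gen_min A J : ideal_of [set: R] J -> A `<=` J -> ideal_gen A `<=` J.
Proof. exact: smallest_sub. Qed.

Lemma ideal_gen_ideal A : ideal_of [set: R] (ideal_gen A).
Proof.
split=> //.
- by move=> J /= [[_ J0 _ _] _].
- move=> x y Ax Ay J /= JP; have [[_ _ JD _] _] := JP.
  by apply: JD; [apply: Ax | apply: Ay].
- move=> b x _ Ax J /= JP; have [[_ _ _ JM] _] := JP.
  by apply: JM => //; apply: Ax.
Qed.

Lemma ideal_gen_sub A B : A `<=` ideal_gen B -> ideal_gen A `<=` ideal_gen B.
Proof. exact: ideal_gen_min (ideal_gen_ideal B). Qed.

Lemma ideal_sum J (T : eqType) (r : seq T) (F : T -> R) :
    ideal_of [set: R] J -> (forall t, t \in r -> J (F t)) ->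
  J (\sum_(t <- r) F t).
Proof.
case=> _ J0 JD _ JF; rewrite big_seq_cond.
by apply: big_ind => // t /andP[+ _]; apply: JF.
Qed.

(** Fixing one factor at a time, the elements whose product with it lies in
    the right-hand side form an ideal, so generators suffice on both sides. *)
Lemma ideal_mul_gen A B :
  ideal_mul (ideal_gen A) (ideal_gen B) =
  ideal_gen [set z | exists x y, [/\ A x, B y & z = x * y]].
Proof.
rewrite eqEsubset; split; apply: ideal_gen_sub => z [x [y [Ax By ->]]]; last first.
  by apply: sub_ideal_gen; exists x, y; split => //; apply: sub_ideal_gen.
set J := ideal_gen _; have [_ J0 JD JM] : ideal_of [set: R] J.
  exact: ideal_gen_ideal.
have JAb b : B b -> forall a, ideal_gen A a -> J (a * b).
  move=> Bb; apply: (@ideal_gen_min A [set a | J (a * b)]).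
    split=> //= [|a a' Ja Ja'|c a _ Ja]; first by rewrite mul0r.
      by rewrite mulrDl; apply: JD.
    by rewrite -mulrA; apply: JM.
  by move=> a Aa /=; apply: sub_ideal_gen; exists a, b.
move: y By; apply: (@ideal_gen_min B [set y | J (x * y)]).
  split=> //= [|b b' Jb Jb'|c b _ Jb]; first by rewrite mulr0.
    by rewrite mulrDr; apply: JD.
  by rewrite mulrCA; apply: JM.
by move=> b Bb /=; apply: JAb.
Qed.

Lemma ideal_exp2 J : ideal_exp J 2 = ideal_mul J J.
Proof. by []. Qed.

Lemma ideal_exp2_sub J J' : J `<=` J' -> ideal_exp J 2 `<=` ideal_exp J' 2.
Proof.
move=> sJ; rewrite !ideal_exp2; apply: ideal_gen_sub => z [x [y [Jx Jy ->]]].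
by apply: sub_ideal_gen; exists x, y; split => //; apply: sJ.
Qed.

Lemma prime_idealP (P : set R) :
  prime_ideal P <->
  [/\ ideal_of [set: R] P, ~ P 1 & forall x y, P (x * y) -> P x \/ P y].
Proof.
split=> [[[P0 P1 PD] PM]|[[_ P0 PD PM] P1 Ppr]].
  have {}P0 : P 0 by move: P0; rewrite !inE.
  have {}PD a x y : P x -> P y -> P (a * x + y).
    move=> Px Py; suff: a * x + y \in [pred x in P] by rewrite !inE.
    by apply: PD; rewrite !inE.
  split.
  - split=> // [x y Px Py|b x _ Px]; first by rewrite -[x]mul1r; apply: PD.
    by rewrite -[b * x]addr0; apply: PD.
  - by move=> P1'; move/negP: P1; apply; rewrite !inE.
  - move=> x y Pxy; have /orP[] : (x \in [pred x in P]) || (y \in [pred x in P]).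
      by apply: PM; rewrite !inE.
    + by rewrite !inE; left.
    + by rewrite !inE; right.
split; first split.
- by rewrite !inE.
- by apply/negP; rewrite !inE.
- move=> a x y; rewrite !inE => Px Py; apply: PD => //; exact: PM.
- move=> x y; rewrite !inE => /Ppr[Px|Py]; apply/orP; [left|right];
  by rewrite !inE.
Qed.

End IdealGeneration.

(** * Powers in a localization *)

Section Localization.
Variable S : idomainType.
Implicit Types (P J : set S).
Local Open Scope classical_set_scope.

(** Fractions with numerator in an ideal [J] and denominator outside [P] form
    an ideal of the localization, hence contain [local_power P k] as soon as
    [J] contains the power itself. *)
Lemma local_power_denom P J k (f : S) : prime_ideal P -> ideal_of [set: S] J ->
    ideal_exp P k `<=` J -> local_power P k (tofrac f) ->
  exists2 s, ~ P s & J (f * s).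
Proof.
move=> /prime_idealP[[_ P0 _ _] P1 Ppr] [_ J0 JD JM] sPJ.
have nP0 s : ~ P s -> tofrac s != 0.
  by move=> Ps; rewrite tofrac_eq0; apply/eqP => s0; rewrite s0 in Ps.
have nPM s t : ~ P s -> ~ P t -> ~ P (s * t) by move=> Ps Pt /Ppr[].
pose Z := [set z | exists a s, [/\ J a, ~ P s & z = tofrac a / tofrac s]].
suff sZ : local_power P k `<=` Z.
  move/sZ=> [a [s [Ja Ps eqf]]]; exists s => //.
  suff -> : f * s = a by [].
  apply/eqP; rewrite -tofrac_eq tofracM eqf divfK //; exact: nP0.
apply: smallest_sub; last first.
  move=> _ [x Px <-]; exists x, 1; split=> //; first exact: sPJ.
  by rewrite tofrac1 divr1.
split=> [z [a [s [_ Ps ->]]]||z w [a [s [Ja Ps ->]]] [b [t [Jb Pt ->]]]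
        |z w [a [s [Ps ->]]] [b [t [Jb Pt ->]]]].
- by exists a, s.
- by exists 0, 1; split; rewrite // tofrac0 mul0r.
- exists (a * t + b * s), (s * t); split; last 1 first.
  + by rewrite addf_div ?nP0 // !tofracM tofracD !tofracM.
  + by apply: JD; rewrite mulrC; apply: JM.
  + exact: nPM.
- exists (a * b), (s * t); split; [exact: JM|exact: nPM|].
  by rewrite mulf_div !tofracM.
Qed.

End Localization.

(** * The filtration by order of vanishing *)

Section OrderFiltration.
Variables (R : comNzRingType) (A : idomainType) (phi : {rmorphism R -> {poly A}}).
Local Open Scope classical_set_scope.

(** The preimage of the powers of [('X)]: each grading of [R] by a morphism to a
    polynomial ring filters [R] by the lowest degree that occurs. *)
Definition order_ge (k : nat) : set R :=
  [set f | forall d, (d < k)%N -> (phi f)`_d = 0].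

Lemma order_ge_ideal k : ideal_of [set: R] (order_ge k).
Proof.
split=> [//|d _|x y xk yk d dk|b x _ xk d dk].
- by rewrite rmorph0 coef0.
- by rewrite rmorphD coefD xk // yk // addr0.
- rewrite rmorphM coefM big1 // => j _.
  by rewrite xk ?mulr0 // (leq_ltn_trans (leq_subr j d)).
Qed.

Lemma order_ge_mul k l x y :
  order_ge k x -> order_ge l y -> order_ge (k + l) (x * y).
Proof.
move=> xk yl d dkl; rewrite rmorphM coefM big1 // => j _.
case: (ltnP j k) => [/xk->|kj]; first by rewrite mul0r.
rewrite yl ?mulr0 // ltn_subLR; last by rewrite -ltnS.
by rewrite (leq_trans dkl) // leq_add2r.
Qed.

Lemma order_ge_exp2 : ideal_exp (order_ge 1) 2 `<=` order_ge 2.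
Proof.
apply: ideal_gen_min (order_ge_ideal 2) _ => _ [x [y [x1 y1 ->]]].
exact: order_ge_mul x1 y1.
Qed.

(** The lowest coefficient of a product is the product of the lowest
    coefficients, so a factor of order 0 contributes nothing to the order. *)
Lemma order_ge_cancel k x s :
  ~ order_ge 1 s -> order_ge k (x * s) -> order_ge k x.
Proof.
move=> s0 xsk; elim/ltn_ind=> d IHd dk.
have {}s0 : (phi s)`_0 != 0.
  by apply/eqP => s0'; apply: s0 => -[].
have := xsk d dk; rewrite rmorphM coefM big_ord_recr /= subnn big1 => [|j _].
  by move/eqP; rewrite add0r mulf_eq0 (negbTE s0) orbF => /eqP.
by rewrite IHd ?mul0r // (ltn_trans _ dk).
Qed.

Lemma order_ge1_prime : prime_ideal (order_ge 1).
Proof.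
apply/prime_idealP; split=> [|/(_ 0 isT)/eqP|x y xy].
- exact: order_ge_ideal.
- by rewrite rmorph1 coef1 oner_eq0.
- case: (pselect (order_ge 1 y)) => [|/order_ge_cancel y1]; first by right.
  by left; apply: y1.
Qed.

End OrderFiltration.

(** * Monomial ideals *)

Section Monomials.
Variables (n : nat) (K : fieldType).
Local Notation S := {mpoly K[n]}.
Implicit Types (J : set S) (H L C : {set 'I_n}) (m : 'X_{1..n}) (f : S).
Local Open Scope classical_set_scope.

Lemma ideal_mpolyX J f : ideal_of [set: S] J ->
  (forall m, m \in msupp f -> J 'X_[m]) -> J f.
Proof.
move=> idJ Jf; rewrite [f]mpolyE; apply: ideal_sum => // m /Jf Jm.
by rewrite -mul_mpolyC; case: idJ => _ _ _; apply.
Qed.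

Lemma ideal_mpolyX_le J m m' : ideal_of [set: S] J ->
  (m <= m')%MM -> J 'X_[m] -> J 'X_[m'].
Proof.
by case=> _ _ _ JM le_mm' Jm; rewrite -(submK le_mm') mpolyXD; apply: JM.
Qed.

(** The polynomials all of whose monomials are multiples of monomials of [M]
    already form an ideal. *)
Lemma mem_monomial_ideal (M : set 'X_{1..n}) f :
  ideal_gen ((fun m => 'X_[m] : S) @` M) f <->
  forall m, m \in msupp f -> exists2 m0, M m0 & (m0 <= m)%MM.
Proof.
split; last first.
  move=> Mf; apply: ideal_mpolyX; first exact: ideal_gen_ideal.
  move=> m /Mf[m0 Mm0 le_m0]; apply: ideal_mpolyX_le le_m0 _.
    exact: ideal_gen_ideal.
  by apply: sub_ideal_gen; exists m0.
move: f; apply: (@ideal_gen_min _ _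
  [set f : S | forall m, m \in msupp f -> exists2 m0, M m0 & (m0 <= m)%MM]).
  split=> //= [m|f g Mf Mg m|f g _ Mg m].
  - by rewrite msupp0.
  - by move/msuppD_le; rewrite mem_cat => /orP[/Mf|/Mg].
  - move/msuppM_le/allpairsP=> [[m1 m2] /= [_ /Mg[m0 Mm0 le_m0] ->]].
    exists m0 => //; apply/mnm_lepP=> i.
    by rewrite mnmDE (leq_trans (mnm_lepP le_m0 i)) // leq_addl.
move=> _ [m0 Mm0 <-] m /=; rewrite msuppX inE => /eqP->.
by exists m0 => //; apply: lepm_refl.
Qed.

Definition setmnm H : 'X_{1..n} := [multinom ((i \in H) : nat) | i < n].

Lemma xsetE H : xset K H = 'X_[setmnm H].
Proof.
rewrite mpolyXE_id /xset big_mkcond; apply: eq_bigr => i _.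
by rewrite mnmE; case: (i \in H).
Qed.

Lemma setmnm_le H L : (setmnm H <= setmnm L)%MM = (H \subset L).
Proof.
apply/mnm_lepP/fintype.subsetP=> [le_HL i iH|sHL i]; last first.
  by rewrite !mnmE; case: (boolP (i \in H)) => // /sHL->.
by have := le_HL i; rewrite !mnmE iH; case: (i \in L).
Qed.

Lemma setmnm_inj : injective setmnm.
Proof.
move=> H L eqHL; apply/eqP.
by rewrite finset.eqEsubset -!setmnm_le eqHL lepm_refl.
Qed.

Lemma xset_inj : injective (@xset n K).
Proof.
move=> H L; rewrite !xsetE => /(congr1 (@msupp _ _)); rewrite !msuppX => eqX.
by apply: setmnm_inj; have /= := congr1 (head 0%MM) eqX.
Qed.

Lemma image_xset (E : set {set 'I_n}) :
  @xset n K @` E = (fun m => 'X_[m] : S) @` (setmnm @` E).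
Proof.
apply/seteqP; split=> [_ [H EH <-]|_ [_ [H EH <-] <-]].
  by exists (setmnm H); [exists H|rewrite xsetE].
by exists H => //; rewrite xsetE.
Qed.

Lemma mem_xset_ideal (E : set {set 'I_n}) f :
  ideal_gen (@xset n K @` E) f <->
  forall m, m \in msupp f -> exists2 H, E H & (setmnm H <= m)%MM.
Proof.
rewrite image_xset mem_monomial_ideal; split=> Ef m /Ef.
  by case=> _ [H EH <-] le_Hm; exists H.
by case=> H EH le_Hm; exists (setmnm H) => //; exists H.
Qed.

Lemma mem_xset_ideal_sqr (E : set {set 'I_n}) f :
  ideal_exp (ideal_gen (@xset n K @` E)) 2 f <->
  forall m, m \in msupp f ->
    exists H L, [/\ E H, E L & (setmnm H + setmnm L <= m)%MM].
Proof.
rewrite ideal_exp2 ideal_mul_gen.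
rewrite (_ : mkset _ = (fun m => 'X_[m] : S) @`
  [set m | exists H L, [/\ E H, E L & m = (setmnm H + setmnm L)%MM]]).
  rewrite mem_monomial_ideal; split=> Ef m /Ef.
    by case=> _ [H [L [EH EL ->]]] le_m; exists H, L.
  by case=> H [L [EH EL le_m]]; exists (setmnm H + setmnm L)%MM => //; exists H, L.
apply/seteqP; split=> [_ [_ [_ [[H EH <-] [L EL <-] ->]]]|_ [_ [H [L [EH EL ->]]] <-]].
  by exists (setmnm H + setmnm L)%MM; [exists H, L|rewrite mpolyXD !xsetE].
by exists (xset K H), (xset K L); split; [exists H|exists L|rewrite mpolyXD !xsetE].
Qed.

End Monomials.
Arguments setmnm {n} H.

(** * The edges generate the ideal *)

Section Edges.
Variables (n : nat) (K : fieldType).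
Local Notation S := {mpoly K[n]}.
Implicit Types (I : set S) (H L C : {set 'I_n}).
Local Open Scope classical_set_scope.

Lemma hypergraph_sub I H : hypergraph I H -> I (xset K H).
Proof. by case=> G [[_ <-] _] GH; apply: sub_ideal_gen. Qed.

Lemma minset_edge (A : set {set 'I_n}) L : A L ->
  exists2 L', minset (fun L => `[< A L >]) L' & L' \subset L.
Proof.
move=> /asboolP AL.
have [L' ? ?] := minset_exists (P := fun L => `[< A L >]) AL.
by exists L'.
Qed.

(** The inclusion-minimal members of a generating family are minimal
    generators: a monomial dividing [x^H] that remains among them must be
    [x^H] itself, so none can be dropped. *)
Lemma hypergraph_minset (A : set {set 'I_n}) H :
  minset (fun L => `[< A L >]) H -> hypergraph (ideal_gen (@xset n K @` A)) H.
Proof.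
move=> minH; pose M := [set L | minset (fun L' => `[< A L' >]) L].
have genM : ideal_gen (@xset n K @` M) = ideal_gen (@xset n K @` A).
  rewrite eqEsubset; split; apply: ideal_gen_sub => _ [L AL <-].
    by apply: sub_ideal_gen; exists L => //; apply/asboolP; apply: minsetp AL.
  have [L' minL' sL'L] := minset_edge AL.
  rewrite mem_xset_ideal => m; rewrite xsetE msuppX inE => /eqP->.
  by exists L'; rewrite ?setmnm_le.
exists (@xset n K @` M); last by exists H.
split=> [|G [Gmon genG] sGM].
  by split=> // _ [L _ <-]; exists (setmnm L); rewrite ?xsetE.
apply/seteqP; split=> // _ [L minL <-].
have Geq : G = @xset n K @` [set L' | G (xset K L')].
  apply/seteqP; split=> [g Gg|_ [L' GL' <-] //].
  by have [L' _ eL'] := sGM _ Gg; exists L' => //=; rewrite eL'.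
have : ideal_gen G (xset K L).
  by rewrite genG -genM; apply: sub_ideal_gen; exists L.
rewrite Geq mem_xset_ideal => /(_ (setmnm L)).
rewrite xsetE msuppX inE eqxx => /(_ isT)[L' /= GL'].
rewrite setmnm_le => sL'L.
have [L'' minL'' /xset_inj eL'] := sGM _ GL'.
move: minL''; rewrite eL' => /minsetp AL'.
by exists L' => //; rewrite -xsetE (minsetinf minL AL' sL'L).
Qed.

Lemma ideal_gen_hypergraph I : squarefree_monomial_ideal I ->
  I = ideal_gen (@xset n K @` hypergraph I).
Proof.
case=> A defI; rewrite eqEsubset; split.
  rewrite {1}defI; apply: ideal_gen_sub => _ [L AL <-].
  have [L' minL' sL'L] := minset_edge AL.
  rewrite mem_xset_ideal => m; rewrite xsetE msuppX inE => /eqP->.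
  by exists L'; rewrite ?setmnm_le //= defI; apply: hypergraph_minset.
apply: ideal_gen_min; last by move=> _ [H EH <-]; apply: hypergraph_sub.
by rewrite defI; apply: ideal_gen_ideal.
Qed.

End Edges.

(** * Minimal vertex covers and minimal primes *)

Section CoordinatePrime.
Variables (n : nat) (K : fieldType).
Local Notation S := {mpoly K[n]}.
Implicit Types (I P Q : set S) (H L C : {set 'I_n}) (m : 'X_{1..n}) (f g : S).
Local Open Scope classical_set_scope.

Definition weight C m : nat := (\sum_(i in C) m i)%N.

(** The substitution [x_i := x_i * T] for [i] in [C]; the coefficient of [T ^ d]
    is the component of weight [d]. *)
Definition grade C : S -> {poly S} :=
  mmap (polyC \o @mpolyC n K) (fun i => ('X_i)%:P * 'X^(i \in C)).

HB.instance Definition _ C := GRing.RMorphism.on (grade C).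

Lemma coef_grade C f d m :
  (grade C f)`_d@_m = f@_m *+ (weight C m == d).
Proof.
rewrite /grade /mmap coef_sum raddf_sum /=.
rewrite [in RHS](mpolyE f) raddf_sum /= -sumrMnl; apply: eq_bigr => k _.
have -> : mmap1 (fun i => ('X_i : S)%:P * 'X^(i \in C)) k
          = ('X_[k] : S)%:P * 'X^(weight C k).
  rewrite /mmap1 (mpolyXE_id _ k) rmorph_prod /weight -prodrXr.
  rewrite [X in _ * X]big_mkcond -big_split /=; apply: eq_bigr => i _.
  by rewrite exprMn rmorphXn /= -exprM; case: (i \in C); rewrite ?mul1n ?mul0n.
rewrite coefCM coefCM coefXn mulr_natr mcoeffCM raddfMn /= mcoeffZ mcoeffX.
case: eqVneq => [->|_]; last by rewrite mulr0 !mul0rn mulr0.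
by rewrite eq_sym mulrnAr.
Qed.

Lemma order_ge_grade C k f :
  order_ge (grade C) k f <-> forall m, m \in msupp f -> (k <= weight C m)%N.
Proof.
split=> [fk m|fk d dk].
  rewrite mcoeff_msupp; apply: contraR; rewrite -ltnNge => /fk w0.
  by have := coef_grade C f (weight C m) m; rewrite w0 mcoeff0 eqxx mulr1n => <-.
apply/mpolyP => m; rewrite coef_grade mcoeff0.
have [/fk km|/memN_msupp_eq0->] := boolP (m \in msupp f); last by rewrite mul0rn.
by rewrite gtn_eqF // (leq_trans dk).
Qed.

(** The polynomials without component of weight 0, that is, the ideal generated
    by the variables of [C].  As the kernel of a morphism into a domain it is
    visibly prime. *)
Definition coordinate_prime C : set S := order_ge (grade C) 1.

Lemma weight_setmnm C H : (0 < weight C (setmnm H))%N <-> exists2 i, i \in H & i \in C.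
Proof.
rewrite /weight lt0n sum_nat_eq0; split=> [/forall_inPn[i iC]|[i iH iC]].
  by rewrite mnmE; case: (boolP (i \in H)) => // iH _; exists i.
by apply/forall_inPn; exists i; rewrite // mnmE iH.
Qed.

Definition vertex_cover (E : set {set 'I_n}) C : Prop :=
  forall H, E H -> exists2 i, i \in H & i \in C.

Lemma prime_mem_prod P H : prime_ideal P -> P (xset K H) ->
  exists2 i, i \in H & P 'X_i.
Proof.
case/prime_idealP=> _ P1 Ppr; rewrite /xset; apply: contraPP => nP.
apply: (big_ind (fun x => ~ P x)) => // [x y Px Py /Ppr[]//|i iH Pi].
by apply: nP; exists i.
Qed.

(** Minimality of [C] gives, for each [i] in [C], an edge meeting [C] only
    in [i]; a prime inside the coordinate prime and containing [I] contains a
    variable of that edge, which can only be [x_i]. *)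
Lemma minimal_prime_coordinate (E : set {set 'I_n}) C :
  minset (fun C => `[< vertex_cover E C >]) C ->
  minimal_prime (ideal_gen (@xset n K @` E)) (coordinate_prime C).
Proof.
case/minsetP=> /asboolP covC minC.
have idC : prime_ideal (coordinate_prime C) := order_ge1_prime _.
split=> // [|Q prQ EQ sQC].
  case/prime_idealP: idC => idC _ _; apply: ideal_gen_min => // _ [H /covC EH <-].
  apply/order_ge_grade=> m; rewrite xsetE msuppX inE => /eqP->.
  exact/weight_setmnm.
have [idQ _ _] := (prime_idealP Q).1 prQ.
have QX i : i \in C -> Q 'X_i.
  move=> iC; have [H EH Hi] : exists2 H, E H & forall j, j \in H -> j \in C -> j = i.
    apply: contrapT => nE; have : C :\ i = C.
      apply: minC; last exact: subD1set.
      apply/asboolP => H EH; apply: contrapT => nH; apply: nE; exists H => //.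
      move=> j jH jC; apply/eqP; apply: contrapT => /negP ji; apply: nH.
      by exists j => //; rewrite !inE ji.
    by move/setP/(_ i); rewrite !inE eqxx iC.
  have [j jH Qj] : exists2 j, j \in H & Q 'X_j.
    by apply: prime_mem_prod prQ _; apply: EQ; apply: sub_ideal_gen; exists H.
  suff <- : j = i by []. apply: Hi => //.
  have /order_ge_grade/(_ U_(j)%MM) := sQC _ Qj.
  rewrite msuppX inE eqxx => /(_ isT); rewrite lt0n sum_nat_eq0.
  case/forall_inPn=> k kC; rewrite mnm1E.
  by case: (j =P k) => [->|].
apply/seteqP; split=> // f /order_ge_grade Cf.
apply: ideal_mpolyX => // m /Cf; rewrite lt0n sum_nat_eq0.
case/forall_inPn=> i iC mi; apply: ideal_mpolyX_le (QX i iC) => //.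
by rewrite lep1mP.
Qed.

(** A denominator outside the prime has order 0, so clearing it keeps the
    order at least 2. *)
Lemma symbolic_square_weight I C f m : minimal_prime I (coordinate_prime C) ->
  symbolic_power I 2 f -> m \in msupp f -> (1 < weight C m)%N.
Proof.
move=> minC symf mf.
have [s s1 fs2] := local_power_denom (order_ge1_prime _) (order_ge_ideal _ 2)
  (@order_ge_exp2 _ _ _) (symf _ minC).
exact: (order_ge_grade C 2 f).1 (order_ge_cancel s1 fs2) m mf.
Qed.

End CoordinatePrime.

(** * Special triangles *)

Section Triangles.
Variable n : nat.
Implicit Types (E : set {set 'I_n}) (H L F D C : {set 'I_n}).

Lemma special_triangle_mem E i j k H1 H2 H3 :
    E H1 -> E H2 -> E H3 ->
    [&& i \notin H1, i \in H2 & i \in H3] ->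
    [&& j \in H1, j \notin H2 & j \in H3] ->
    [&& k \in H1, k \in H2 & k \notin H3] ->
  make_special_triangle E H1 H2 H3.
Proof.
move=> E1 E2 E3 /and3P[i1 i2 i3] /and3P[j1 j2 j3] /and3P[k1 k2 k3].
have ij : i != j by apply: contraNneq i1 => ->.
have ik : i != k by apply: contraNneq i1 => ->.
have jk : j != k by apply: contraNneq j2 => ->.
pose facts := (negbTE i1, i2, i3, j1, negbTE j2, j3, k1, k2, negbTE k3).
have diff : (((i == j) = false) * ((i == k) = false) * ((j == k) = false))%type.
  by rewrite !(negbTE ij, negbTE ik, negbTE jk).
exists i, j, k; split=> //; split; apply/setP => x; rewrite !inE;
  (have [->|_] := eqVneq x i; first by rewrite !(facts, diff));
  (have [->|_] := eqVneq x j; first by rewrite !(facts, diff));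
  (have [->|_] := eqVneq x k; first by rewrite !facts);
  by rewrite andbF.
Qed.

(** By induction on the number of common vertices outside [D] of a pair of
    edges in [F]: a common vertex [v] outside [D] is avoided by a third edge, and
    either two of the three edges or the pair supplied by their special triangle
    have fewer. *)
Lemma two_edges_of_special_triangles E F D :
    (exists2 H, E H & H \subset F) ->
    (forall v, v \in F :\: D -> exists2 H, E H & H \subset F :\ v) ->
    (forall H1 H2 H3, make_special_triangle E H1 H2 H3 ->
      exists L L', [/\ E L, E L', L :|: L' \subset H1 :|: H2 :|: H3
                     & L :&: L' \subset H1 :&: H2 :&: H3]) ->
  exists L L', [/\ E L, E L', L :|: L' \subset F & L :&: L' \subset D].
Proof.
move=> [H0 EH0 sH0] avoid tri.
have step N H H' : E H -> E H' -> H :|: H' \subset F ->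
    (#|(H :&: H') :\: D| <= N)%N ->
    exists L L', [/\ E L, E L', L :|: L' \subset F & L :&: L' \subset D].
  elim: N H H' => [|N IHN] H H' EH EH' sF leN.
    exists H, H'; split=> //; rewrite -finset.setD_eq0 -cards_eq0 -leqn0.
    exact: leN.
  have [sD|/subsetPn[v vHH' vD]] := boolP (H :&: H' \subset D).
    by exists H, H'.
  have [vH vH'] : v \in H /\ v \in H' by apply/andP; rewrite -finset.in_setI.
  have smaller L L' : E L -> E L' -> L :|: L' \subset F ->
      L :&: L' \subset (H :&: H') :\ v ->
      exists L L', [/\ E L, E L', L :|: L' \subset F & L :&: L' \subset D].
    move=> EL EL' sLF sLL'; apply: (IHN L L') => //.
    rewrite -ltnS; apply: leq_trans leN; apply: proper_card; apply/properP.
    split; last by exists v; rewrite !inE ?vD ?vH // ; move/fintype.subsetP/(_ v): sLL';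
      rewrite !inE eqxx /=; case: (_ && _) => // /(_ isT).
    by apply: finset.setSD; apply: fintype.subset_trans sLL' (subD1set _ _).
  have [sHF sH'F] : H \subset F /\ H' \subset F by apply/andP; rewrite -finset.subUset.
  (* [v] was in [H :&: H'], so a pair meeting inside [(H :&: H') :\ v] is better. *)
  have [H'' EH''] : exists2 H'', E H'' & H'' \subset F :\ v.
    by apply: avoid; rewrite !inE vD (fintype.subsetP sHF).
  rewrite subsetD1 => /andP[sH''F vH''].
  have [s1|/subsetPn[j]] := boolP (H :&: H'' \subset H').
    apply: (smaller H H'') => //; first by rewrite finset.subUset sHF.
    by rewrite subsetD1 finset.subsetI subsetIl s1 !inE negb_and vH'' orbT.
  have [s2|/subsetPn[i]] := boolP (H' :&: H'' \subset H).
    move=> _ _; apply: (smaller H' H'') => //; first by rewrite finset.subUset sH'F.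
    by rewrite subsetD1 finset.subsetI subsetIl s2 !inE negb_and vH'' orbT.
  rewrite !inE => /andP[iH' iH''] iH /andP[jH jH''] jH'.
  have [|L [L' [EL EL' sU sI]]] := tri H H' H''.
    by apply: (@special_triangle_mem _ i j v); rewrite // ?iH ?iH' ?jH ?jH' ?vH ?vH'.
  apply: (smaller L L') => //.
    by apply: fintype.subset_trans sU _; rewrite !finset.subUset sHF sH'F.
  apply: fintype.subset_trans sI _.
  by rewrite subsetD1 subsetIl !inE negb_and vH'' orbT.
by apply: (step _ H0 H0 EH0 EH0 _ (leqnn _)); rewrite finset.subUset sH0.
Qed.

(** The complement of a set without edges is a vertex cover, so the weight
    condition on covers yields edges in the support of [m], even after removal
    of any one vertex of exponent 1. *)
Lemma setmnm_pair_le E m :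
    (forall C, vertex_cover E C -> (1 < weight C m)%N) ->
    (forall H1 H2 H3, make_special_triangle E H1 H2 H3 ->
      exists L L', [/\ E L, E L', L :|: L' \subset H1 :|: H2 :|: H3
                     & L :&: L' \subset H1 :&: H2 :&: H3]) ->
  exists L L', [/\ E L, E L' & (setmnm L + setmnm L' <= m)%MM].
Proof.
move=> wm tri; pose F := [set i | (0 < m i)%N]%SET; pose D := [set i | (1 < m i)%N]%SET.
have edge_in G : (weight (~: G) m <= 1)%N -> exists2 H, E H & H \subset G.
  move=> wG; apply: contrapT => nE; have /wm : vertex_cover E (~: G).
    move=> H EH; have /subsetPn[i iH iG] : ~~ (H \subset G).
      by apply/negP => sHG; apply: nE; exists H.
    by exists i => //; rewrite inE.
  by rewrite ltnNge wG.
have F0 i : i \notin F -> m i = 0%N by rewrite inE lt0n negbK => /eqP.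
have [||L [L' [EL EL' sF sD]]] :=
  two_edges_of_special_triangles (F := F) (D := D) _ _ tri.
- by apply: edge_in; rewrite /weight big1 // => i; rewrite inE => /F0.
- move=> v; rewrite !inE -leqNgt => /andP[mv1 mv0]; apply: edge_in.
  rewrite /weight (bigD1 v) /=; last by rewrite !inE eqxx.
  rewrite big1 ?addn0 // => i /andP[].
  rewrite finset.in_setC in_setD1 => /nandP[/negPn->//|].
  by move/F0.
exists L, L'; split=> //; apply/mnm_lepP => i; rewrite mnmDE !mnmE.
have /implyP := fintype.subsetP sF i; have /implyP := fintype.subsetP sD i.
by rewrite !inE; case: (i \in L); case: (i \in L').
Qed.

End Triangles.

(** * The symbolic square *)

Section Main.
Variables (n : nat) (K : fieldType) (I : set {mpoly K[n]}).
Local Notation S := {mpoly K[n]}.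
Local Open Scope classical_set_scope.

Lemma ideal_exp2_sub_symbolic : ideal_exp I 2 `<=` symbolic_power I 2.
Proof.
move=> f If P [_ sIP _]; apply: sub_gen_smallest; exists f => //.
exact: ideal_exp2_sub sIP f If.
Qed.

(** Each prime over [I] contains either a variable common to the three sets,
    which divides the product twice, or two distinct variables of the union. *)
Lemma triple_in_symbolic (H1 H2 H3 : {set 'I_n}) :
    I (xset K H1) -> I (xset K H2) -> I (xset K H3) ->
  symbolic_power I 2 (xset K (H1 :&: H2 :&: H3) * xset K (H1 :|: H2 :|: H3)).
Proof.
move=> I1 I2 I3 P [prP sIP _]; apply: sub_gen_smallest.
set u := _ * _; exists u => //.
have XX i j : P 'X_i -> P 'X_j ->
    (U_(i) + U_(j) <= setmnm (H1 :&: H2 :&: H3) + setmnm (H1 :|: H2 :|: H3))%MM ->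
    ideal_exp P 2 u.
  move=> Pi Pj le_ij; rewrite /u !xsetE -mpolyXD ideal_exp2.
  apply: ideal_mpolyX_le le_ij _; first exact: ideal_gen_ideal.
  by apply: sub_ideal_gen; exists 'X_i, 'X_j; rewrite mpolyXD.
have [v v1 Pv] := prime_mem_prod prP (sIP _ I1).
have [v23|] := boolP ((v \in H2) && (v \in H3)).
  apply: (XX v v) => //; apply/mnm_lepP => x.
  rewrite !mnmDE !mnm1E !mnmE !inE; case: eqP => [<-|//].
  by rewrite v1 v23.
have two H' : I (xset K H') -> H' \subset H1 :|: H2 :|: H3 -> v \notin H' ->
    ideal_exp P 2 u.
  move=> /sIP/(prime_mem_prod prP)[w wH' Pw] sH' vH'.
  have vw : v != w by apply: contraNneq vH' => ->.
  apply: (XX v w) => //; apply/mnm_lepP => x.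
  rewrite !mnmDE !mnm1E; apply: leq_trans (leq_addl _ _); rewrite mnmE.
  case: eqP => [<-|_]; first by rewrite eq_sym (negbTE vw) !inE v1.
  by case: eqP => [<-|//]; rewrite (fintype.subsetP sH').
case/nandP; [apply: (two H2)|apply: (two H3)] => //.
  by rewrite (fintype.subset_trans _ (finset.subsetUl _ _)) // finset.subsetUr.
by rewrite finset.subsetUr.
Qed.

End Main.

Theorem theorem4p3 (K : fieldType) (n : nat) (I : set {mpoly K[n]})
    (hI : squarefree_monomial_ideal I) :
  symbolic_power I 2 = ideal_exp I 2
  <->
  (forall H1 H2 H3 : {set 'I_n},
     make_special_triangle (hypergraph I) H1 H2 H3 ->
     ideal_exp I 2 (xset K (H1 :&: H2 :&: H3) * xset K (H1 :|: H2 :|: H3))).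
Proof.
have defI := ideal_gen_hypergraph hI.
split=> [<- H1 H2 H3 [i [j [k [_ [E1 E2 E3] _]]]]|tri].
  by apply: triple_in_symbolic; apply: hypergraph_sub.
apply/seteqP; split; last exact: ideal_exp2_sub_symbolic.
move=> f symf; rewrite defI; apply/mem_xset_ideal_sqr => m mf.
apply: setmnm_pair_le => [C covC|H1 H2 H3 /tri].
  have [] := minset_exists (P := fun C => `[< vertex_cover (hypergraph I) C >]) (C := C).
    exact/asboolP.
  move=> C' minC' sC'C.
  have minP : minimal_prime I (coordinate_prime C').
    by rewrite {1}defI; apply: minimal_prime_coordinate.
  apply: leq_trans (symbolic_square_weight minP symf mf) _.
  rewrite /weight [X in (_ <= X)%N](big_setID C') /= (finset.setIidPr sC'C).
  exact: leq_addr.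
rewrite {1}defI !xsetE -mpolyXD => /mem_xset_ideal_sqr.
rewrite msuppX => /(_ _ (mem_head _ _))[L [L' [EL EL' /mnm_lepP le]]].
exists L, L'; split=> //; apply/fintype.subsetP => x;
  have := le x; rewrite !mnmDE !mnmE !inE;
  by case: (x \in L); case: (x \in L'); case: (x \in H1); case: (x \in H2); case: (x \in H3).
Qed.
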